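(* Let $\alpha,\beta,\gamma$ be partitions. The Littlewood-Richardson coefficient $c_{\alpha,\gamma}^{\beta}$, i.e. the number of LR-tableaux of shape $(\alpha,\beta,\gamma)$, equals the number of socle tableaux of shape $(\alpha,\beta,\gamma)$.
   Context: The Young diagram of a partition $\lambda=(\lambda_1\ge\lambda_2\ge\cdots)$ is drawn with columns of lengths $\lambda_1,\lambda_2,\dots$ from left to right, aligned at the top; rows are numbered from top to bottom, columns from left to right. $\lambda'$ denotes the transpose, so $\lambda'_i=\#\{j:\lambda_j\ge i\}$ is the length of the $i$-th row. If $\gamma\le\beta$ (i.e. $\gamma_i\le\beta_i$ for all $i$), the skew diagram $\beta\setminus\gamma$ consists of the boxes in row $r$ and column $j$ with $\gamma_j<r\le\beta_j$. Tableaux of shape $(\alpha,\beta,\gamma)$ exist only if $\gamma\le\beta$ and $|\alpha|+|\gamma|=|\beta|$. An LR-tableau of shape $(\alpha,\beta,\gamma)$ is a filling of $\beta\setminus\gamma$ with $\alpha'_1$ entries $1$, $\alpha'_2$ entries $2$, etc., such that: (LR-1) in each row, the entries are weakly increasing (left to right); (LR-2) in each column, the entries are strictly increasing (top to bottom); (LR-3) for each vertical line and each natural number $\ell\ge1$, there are at most as many entries $\ell+1$ on the right hand side of the line as there are entries $\ell$. A socle tableau of shape $(\alpha,\beta,\gamma)$ is a filling of $\beta\setminus\gamma$ with $\alpha'_1$ entries $1$, $\alpha'_2$ entries $2$, etc., such that: (ST-1) in each row, the entries are weakly decreasing (left to right); (ST-2) in each column, the entries are strictly decreasing (top to bottom);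 (ST-3) for each vertical line and each natural number $\ell\ge1$, there are at most as many entries $\ell+1$ on the left hand side of the line as there are entries $\ell$. *)

(* Defs.v *)
From mathcomp Require Import all_boot.

Set Implicit Arguments.
Unset Strict Implicit.
Unset Printing Implicit Defensive.

(* Rows, columns and parts are numbered from 0, whereas the entries of a      *)
(* tableau are positive integers.  The parts of a partition are the lengths   *)
(* of the columns of its Young diagram.                                       *)

Definition is_partition (la : seq nat) : bool := sorted geq la && (0 \notin la).

(* The length la'_i of the i-th row, where i >= 1 (here 1-based). *)
Definition transpose (la : seq nat) (i : nat) : nat := count (leq i) la.

Definition included (ga be : seq nat) : bool :=
  all (fun j => nth 0 ga j <= nth 0 be j) (iota 0 (size ga)).

(* (r, j) stands for the box in row r.+1 and column j.+1; the condition       *)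
(* ga_j < r.+1 <= be_j of the 1-based numbering becomes ga_j <= r < be_j.     *)
Definition in_skew (be ga : seq nat) (x : 'I_(head 0 be) * 'I_(size be)) :=
  nth 0 ga x.2 <= x.1 < nth 0 be x.2.

Definition box (be ga : seq nat) := {x | @in_skew be ga x}.

Definition brow be ga (x : box be ga) : nat := (val x).1.
Definition bcol be ga (x : box be ga) : nat := (val x).2.

(* No entry can exceed al_1 = head 0 al, since al'_l = 0 for l > al_1. *)
Definition filling (al be ga : seq nat) :=
  {ffun box be ga -> 'I_(head 0 al).+1}.

Section Tableaux.

Variables al be ga : seq nat.
Implicit Types (T : filling al be ga) (c l : nat).

(* The vertical line numbered c has columns 0, ..., c - 1 on its left. *)
Definition entries_left T c l : nat := #|[pred x | bcol x < c & T x == l :> nat]|.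
Definition entries_right T c l : nat := #|[pred x | c <= bcol x & T x == l :> nat]|.

Definition has_content T : bool :=
  [forall x, 0 < T x] &&
  [forall l : 'I_(head 0 al).+1,
     (0 < l) ==> (#|[pred x | T x == l :> nat]| == transpose al l)].

Definition LR1 T : bool :=
  [forall x, forall y,
     (brow x == brow y) && (bcol x < bcol y) ==> (T x <= T y)].
Definition LR2 T : bool :=
  [forall x, forall y,
     (bcol x == bcol y) && (brow x < brow y) ==> (T x < T y)].
Definition LR3 T : bool :=
  [forall c : 'I_(size be).+1, forall l : 'I_(head 0 al).+1,
     (0 < l) ==> (entries_right T c l.+1 <= entries_right T c l)].

Definition ST1 T : bool :=
  [forall x, forall y,
     (brow x == brow y) && (bcol x < bcol y) ==> (T y <= T x)].
Definition ST2 T : bool :=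
  [forall x, forall y,
     (bcol x == bcol y) && (brow x < brow y) ==> (T y < T x)].
Definition ST3 T : bool :=
  [forall c : 'I_(size be).+1, forall l : 'I_(head 0 al).+1,
     (0 < l) ==> (entries_left T c l.+1 <= entries_left T c l)].

Definition LR_tableau T : bool :=
  [&& included ga be, has_content T, LR1 T, LR2 T & LR3 T].

Definition socle_tableau T : bool :=
  [&& included ga be, has_content T, ST1 T, ST2 T & ST3 T].

(* The bounds on c and l in the definitions above are only there to make them *)
(* boolean: the quantifiers may range over all natural numbers.               *)

Lemma has_contentP T : is_partition al ->
  reflect ((forall x, 0 < T x) /\
           (forall l, 0 < l -> #|[pred x | T x == l :> nat]| = transpose al l))
          (has_content T).
Proof.
move=> /andP[al_sorted _]; apply: (iffP andP) => -[Tpos Tcont]; split.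
- exact/forallP.
- move=> l l_gt0; have [l_le|l_gt] := ltnP l (head 0 al).+1.
    by have /implyP/(_ l_gt0)/eqP := forallP Tcont (Ordinal l_le).
  rewrite eq_card0 => [|x]; last first.
    by rewrite !inE; apply/negbTE; rewrite neq_ltn (leq_trans (ltn_ord _) l_gt).
  apply/esym/eqP; rewrite -leqn0 leqNgt -has_count -all_predC.
  case: al al_sorted l_gt => //= a s s_le_a lt_a_l; rewrite -ltnNge lt_a_l.
  have geq_trans : transitive geq by move=> y x z /= yx zy; apply: leq_trans yx.
  apply: sub_all (order_path_min geq_trans s_le_a) => b /= b_le_a.
  by rewrite -ltnNge (leq_ltn_trans b_le_a).
- exact/forallP.
- by apply/forallP => l; apply/implyP => l_gt0; rewrite Tcont.
Qed.

Lemma LR3P T :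
  reflect (forall c l, 0 < l -> entries_right T c l.+1 <= entries_right T c l)
          (LR3 T).
Proof.
apply: (iffP forallP) => [T3 c l l_gt0 | T3 c]; last first.
  by apply/forallP => l; apply/implyP; apply: T3.
have [c_le|c_gt] := ltnP c (size be).+1; last first.
  rewrite /entries_right [leqLHS]eq_card0 // => x; rewrite !inE leqNgt.
  by rewrite (ltn_trans (ltn_ord _) c_gt).
have [l_le|l_gt] := ltnP l (head 0 al).+1.
  by have /forallP/(_ (Ordinal l_le))/implyP/(_ l_gt0) := T3 (Ordinal c_le).
rewrite /entries_right [leqLHS]eq_card0 // => x; rewrite !inE; apply/negbTE.
by rewrite negb_and neq_ltn (leq_trans (ltn_ord _) (leqW l_gt)) orbT.
Qed.

Lemma ST3P T :
  reflect (forall c l, 0 < l -> entries_left T c l.+1 <= entries_left T c l)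
          (ST3 T).
Proof.
apply: (iffP forallP) => [T3 c l l_gt0 | T3 c]; last first.
  by apply/forallP => l; apply/implyP; apply: T3.
have [l_le|l_gt] := ltnP l (head 0 al).+1; last first.
  rewrite /entries_left [leqLHS]eq_card0 // => x; rewrite !inE; apply/negbTE.
  by rewrite negb_and neq_ltn (leq_trans (ltn_ord _) (leqW l_gt)) orbT.
pose c' := minn c (size be).
have c'E k : entries_left T c k = entries_left T c' k.
  by apply: eq_card => x; rewrite !inE leq_min (ltn_ord (val x).2) andbT.
have c'_le : c' < (size be).+1 by rewrite ltnS geq_minr.
rewrite !c'E.
by have /forallP/(_ (Ordinal l_le))/implyP/(_ l_gt0) := T3 (Ordinal c'_le).
Qed.

End Tableaux.

Definition LR_coef (al be ga : seq nat) : nat := #|@LR_tableau al be ga|.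

(* Main.v *)
Require Import Defs.
From mathcomp Require Import all_boot fingroup perm ssralg ssrint.
From mathcomp Require Import zify.

Set Implicit Arguments.
Unset Strict Implicit.
Unset Printing Implicit Defensive.

(* A socle tableau becomes an LR-tableau of the skew shape rotated by 180     *)
(* degrees.  For any skew shape let K(b) be the number of semistandard        *)
(* fillings of content b; the Bender-Knuth involutions show that K(b) does    *)
(* not change when b is permuted.  Since complementing the entries turns      *)
(* semistandard fillings of the rotated shape into those of the original one  *)
(* and reverses the content, both shapes have the same K.  Finally, the       *)
(* number of LR-tableaux of content a is \sum_s sgn(s) K(s(a + rho) - rho):   *)
(* following Stembridge, the fillings that violate the lattice condition      *)
(* cancel in pairs, by a Bender-Knuth involution applied to the columns to    *)
(* the left of the last violation.                                            *)

(** * Bender-Knuth involutions *)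

(** Rotating a socle tableau by 180 degrees, without changing its entries, reverses rows and columns
    and exchanges left with right: the result is an LR-tableau of the rotated shape with the same
    content. So it suffices that a shape and its rotation have equally many LR-tableaux of a given
    content ([lr_number_rotate]).

    That number is an alternating sum of Kostka numbers ([lr_number_kostka]). The sum runs over
    pairs of a permutation and a semistandard filling; pairs whose filling violates the lattice
    condition cancel under a sign-reversing involution ([flipP]), and for the others the permutation
    must be the identity. Kostka numbers do not see the rotation ([kostka_rotate]): complementing
    the entries only reverses the content, and their symmetry in the content ([kostka_perm]) undoes
    this.

    Cancellation and symmetry both rest on one map [bk], a Bender-Knuth involution confined to the
    columns left of a line ([ssyt_bk], [bkK], [card_bk]). *)

Section ReverseByKey.

Variables (X : finType) (c : X -> nat).
Implicit Types (A : {set X}) (x y : X).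

Definition sort_by A := sort (relpre c leq) (enum A).

Definition rev_by A x :=
  nth x (sort_by A) (size (sort_by A) - (index x (sort_by A)).+1).

Lemma mem_sort_by A : sort_by A =i A.
Proof. by move=> x; rewrite mem_sort mem_enum. Qed.

Lemma sort_by_uniq A : uniq (sort_by A).
Proof. by rewrite sort_uniq enum_uniq. Qed.

Lemma rev_by_in A x : x \in A -> rev_by A x \in A.
Proof.
rewrite -!mem_sort_by => xA; apply: mem_nth; move: xA; rewrite -index_mem.
by move=> lt; rewrite ltn_subrL (leq_ltn_trans _ lt).
Qed.

Lemma rev_byK A : {in A, involutive (rev_by A)}.
Proof.
move=> x; rewrite -mem_sort_by => xA; have ltx := xA; rewrite -index_mem in ltx.
have lt_rev : size (sort_by A) - (index x (sort_by A)).+1 < size (sort_by A).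
  by rewrite ltn_subrL (leq_ltn_trans _ ltx).
rewrite {1}/rev_by {2}/rev_by index_uniq ?sort_by_uniq //.
by rewrite subnSK // subKn ?(ltnW ltx) // (set_nth_default x) ?nth_index.
Qed.

(** Positions in the sorted list are mirrored. Boxes with equal keys are listed in an arbitrary
    order, hence the strict hypothesis and the weak conclusion. *)
Lemma rev_by_anti A x y : x \in A -> y \in A -> c x < c y ->
  c (rev_by A y) <= c (rev_by A x).
Proof.
rewrite -!mem_sort_by => xA yA cxy.
have sorted_A : sorted (relpre c leq) (sort_by A).
  by apply: sort_sorted => u v /=; apply: leq_total.
have leq_nth := @sorted_leq_nth _ _ (fun u v w => @leq_trans (c u) (c v) (c w))
  (fun u => leqnn (c u)) x _ sorted_A.
have ltx := xA; have lty := yA; rewrite -!index_mem in ltx lty.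
have le_xy : index x (sort_by A) <= index y (sort_by A).
  rewrite leqNgt; apply/negP => lt_yx.
  have := leq_nth _ _ lty ltx (ltnW lt_yx).
  by rewrite /= !nth_index // leqNgt cxy.
have lt_rev z : size (sort_by A) - (index z (sort_by A)).+1 < size (sort_by A).
  by rewrite ltn_subrL (leq_ltn_trans _ ltx).
rewrite /rev_by [X in c X <= _](set_nth_default x) //.
by apply: leq_nth; rewrite ?inE ?leq_sub2l.
Qed.

End ReverseByKey.

(** * Bender-Knuth involution to the left of a vertical line *)

Section BenderKnuth.

Variables (X : finType) (r c : X -> nat) (n : nat).

Definition coord_injective := forall x y, r x = r y -> c x = c y -> x = y.

(** The abstract form of a skew shape, chosen because it survives the rotation by 180 degrees. *)
Definition convex := forall x y i j,
  r x <= i <= r y -> c x <= j <= c y -> exists2 z, r z = i & c z = j.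

Implicit Types (f : {ffun X -> 'I_n}) (P : {set X}) (j : nat) (x y z : X).

Definition ssyt f :=
  [forall x, forall y,
     ((r x == r y) && (c x < c y) ==> (f x <= f y)) &&
     ((c x == c y) && (r x < r y) ==> (f x < f y))].

Lemma ssytP f :
  reflect ((forall x y, r x = r y -> c x < c y -> f x <= f y) /\
           (forall x y, c x = c y -> r x < r y -> f x < f y)) (ssyt f).
Proof.
apply: (iffP forallP) => [sf | [sr sc] x].
  split=> x y /eqP e lt; have /forallP/(_ y)/andP[] := sf x.
    by rewrite e lt.
  by rewrite e lt.
by apply/forallP=> y; apply/andP; split; apply/implyP=> /andP[/eqP]; auto.
Qed.

Definition partner P x := [pick y in P | (y != x) && (c y == c x)].

Definition free P j := [set x in P | (c x < j) && ~~ partner P x].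

(* P stands for the set of the boxes with entry k or k'; a free box is one    *)
(* whose column contains only one of the two entries.  Swapping k and k'      *)
(* after moving along tau fixes the paired entries, and turns k^a k'^b into   *)
(* k^b k'^a on the free boxes of a row.                                       *)
Definition tau P j x :=
  if (x \in P) && (c x < j) then
    if partner P x is Some y then y
    else rev_by c [set y in free P j | r y == r x] x
  else x.

Lemma partnerP P x y : partner P x = Some y ->
  [/\ y \in P, y != x & c y = c x].
Proof.
rewrite /partner; case: pickP => // z /and3P[zP zx /eqP czx] [<-].
by split.
Qed.

Lemma partner_freeN P j x y : x \in free P j -> y \in P -> c y = c x -> y = x.
Proof.
rewrite !inE /partner => /and3P[_ _]; case: pickP => // np _ yP cyx.
by apply/eqP; have := np y; rewrite /= yP cyx eqxx andbT => /negbFE.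
Qed.

Lemma tau_free P j x : x \in free P j ->
  tau P j x = rev_by c [set y in free P j | r y == r x] x.
Proof.
by rewrite inE /tau => /and3P[-> ->] /=; case: (partner P x).
Qed.

Lemma tau_free_in P j x : x \in free P j ->
  (tau P j x \in free P j) /\ r (tau P j x) = r x.
Proof.
move=> xF; rewrite tau_free //.
have : x \in [set y in free P j | r y == r x] by rewrite inE xF eqxx.
by move=> /(rev_by_in c); rewrite inE => /andP[-> /eqP].
Qed.

Lemma freeP P j x : x \in free P j -> (x \in P) /\ c x < j.
Proof. by rewrite inE => /and3P[]. Qed.

Variant tau_spec P j x : X -> Type :=
  | TauOut of ~~ ((x \in P) && (c x < j)) : tau_spec P j x x
  | TauPaired y of partner P x = Some y & x \in P & c x < j : tau_spec P j x y
  | TauFree of x \in free P j :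
      tau_spec P j x (rev_by c [set y in free P j | r y == r x] x).

Lemma tauP P j x : tau_spec P j x (tau P j x).
Proof.
rewrite /tau; case: ifPn => [/andP[xP cx]|]; last by constructor.
case E: (partner P x) => [y|]; first by constructor.
by constructor; rewrite inE xP cx E.
Qed.

Lemma tau_lt P j x : (c (tau P j x) < j) = (c x < j).
Proof.
case: (boolP (x \in free P j)) => [xF|].
  by have [/freeP[_ ->] _] := tau_free_in xF; have [_ ->] := freeP xF.
case: tauP => // [y /partnerP[_ _ ->] //|-> //].
Qed.

Lemma tau_in P j x : (tau P j x \in P) = (x \in P).
Proof.
case: (boolP (x \in free P j)) => [xF|].
  by have [/freeP[-> _] _] := tau_free_in xF; have [-> _] := freeP xF.
case: tauP => // [y /partnerP[-> _ _] -> //|-> //].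
Qed.

(** Strict increase down the columns gives this for the boxes with entry [k] or [k']; it makes
    [partner] symmetric and hence [tau] an involution. *)
Definition thin P := forall x y z, x \in P -> y \in P -> z \in P ->
  c y = c x -> c z = c x -> y != x -> z != x -> y = z.

Lemma partner_sym P x y : thin P -> x \in P -> partner P x = Some y ->
  partner P y = Some x.
Proof.
move=> thinP xP /partnerP[yP yx cyx]; rewrite /partner; case: pickP => [z|].
  move=> /and3P[zP zy /eqP czy]; congr Some; apply: (thinP y) => //.
  by rewrite eq_sym.
by move=> /(_ x); rewrite xP cyx eqxx eq_sym yx.
Qed.

Lemma tauK P j : thin P -> involutive (tau P j).
Proof.
move=> thinP x; case: (boolP (x \in free P j)) => [xF|].
  have [tF rt] := tau_free_in xF; rewrite (tau_free tF) rt tau_free //.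
  by apply: rev_byK; rewrite inE xF eqxx.
case: (tauP P j x) => [xN|y xy xP cx|-> //] _.
  by rewrite /tau (negbTE xN).
have [yP _ cyx] := partnerP xy.
by rewrite /tau yP cyx cx (partner_sym thinP xP xy).
Qed.

Section Swap.

Variables (j : nat) (k k' : 'I_n).

Definition level f := [set x | (f x == k) || (f x == k')].

(** For [j] beyond all columns this is the classical involution, used for the symmetry of Kostka
    numbers; for [j] the last violation it is Stembridge's variant. *)
Definition bk f :=
  [ffun x => if c x < j then tperm k k' (f (tau (level f) j x)) else f x].

Hypothesis kk' : k' = k.+1 :> nat.
Hypothesis coord_inj : coord_injective.

Lemma bk_right f x : j <= c x -> bk f x = f x.
Proof. by rewrite ffunE ltnNge => ->. Qed.

Lemma level_bk f : level (bk f) = level f.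
Proof.
apply/setP=> x; rewrite !inE ffunE; case: ifP => // _.
have := tau_in (level f) j x; rewrite !inE => <-.
by case: tpermP => [->|->|/eqP/negbTE-> /eqP/negbTE->];
  rewrite ?eqxx ?orbT.
Qed.

Lemma ssyt_col_inj f x y : ssyt f -> c x = c y -> f x = f y -> x = y.
Proof.
move=> /ssytP[_ sc] cxy fxy; apply: coord_inj => //.
case: (ltngtP (r x) (r y)) => // [lt|gt].
  by have := sc _ _ cxy lt; rewrite fxy ltnn.
by have := sc _ _ (esym cxy) gt; rewrite fxy ltnn.
Qed.

Lemma thin_level f : ssyt f -> thin (level f).
Proof.
move=> sf x y z xP yP zP cyx czx yx zx.
have neq u : c u = c x -> u != x -> f u != f x.
  by move=> cu; apply: contra => /eqP fu; apply/eqP/(ssyt_col_inj sf).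
apply: (ssyt_col_inj sf); first by rewrite cyx.
have := neq _ cyx yx; have := neq _ czx zx; move: xP yP zP; rewrite !inE.
by do 3!case/orP => /eqP->; rewrite ?eqxx.
Qed.

Lemma bkK f : ssyt f -> bk (bk f) = f.
Proof.
move=> sf; apply/ffunP=> x; rewrite ffunE level_bk ffunE tau_lt.
case: ltnP => [cx|ncx]; first by rewrite (tauK j (thin_level sf)) tpermK.
by rewrite bk_right.
Qed.

Lemma card_bk f l : ssyt f ->
  #|[pred x | (c x < j) && (bk f x == l)]| =
  #|[pred x | (c x < j) && (f x == tperm k k' l)]|.
Proof.
move=> sf; have tK := tauK j (thin_level sf).
rewrite -[RHS]cardsE -(on_card_preimset (onW_bij _ (inv_bij tK))).
apply: eq_card => x; rewrite !inE ffunE tau_lt.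
by case: (c x < j) => //=; rewrite (can2_eq (@tpermK _ k k') (@tpermK _ k k')).
Qed.

Lemma bk_nfree f x : ssyt f -> x \notin free (level f) j -> bk f x = f x.
Proof.
move=> sf; rewrite ffunE; case: ifP => // cx; case: tauP => [||->] //.
  rewrite cx andbT inE => /norP[k_x k'_x] _.
  by rewrite tpermD // eq_sym.
move=> y /partnerP[yP yx cyx] xP _ _.
have: f y != f x by apply: contra yx => /eqP /(ssyt_col_inj sf cyx) ->.
by move: xP yP; rewrite !inE => /orP[]/eqP-> /orP[]/eqP->;
  rewrite ?eqxx // ?tpermL ?tpermR.
Qed.

Lemma bk_free f x : x \in free (level f) j ->
  x \in level f /\ bk f x \in [:: k; k'].
Proof.
move=> /freeP[xP _]; split=> //.
by move: xP; rewrite -(level_bk f) !inE.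
Qed.

(* The last hypothesis keeps the rows weakly increasing across the vertical   *)
(* line to the left of column j.                                              *)
Lemma ssyt_bk f : convex -> ssyt f -> (forall x, c x = j -> f x != k) ->
  ssyt (bk f).
Proof.
move=> conv sf colj; have /ssytP[sr sc] := sf.
apply/ssytP; split=> x y.
- move=> rxy cxy.
  case: (boolP (x \in free (level f) j)) => xF; last first.
    case: (boolP (y \in free (level f) j)) => yF; last first.
      by rewrite !bk_nfree // sr.
    rewrite (bk_nfree sf xF); have [+ +] := bk_free yF.
    have fxy := sr _ _ rxy cxy; have [_ cy] := freeP yF; rewrite !inE.
    case/orP=> /eqP fy /orP[] /eqP-> //; rewrite -?fy //.
      rewrite (leq_trans fxy) // fy kk' //.
    (* Otherwise [f x = k'], and [x] is paired with a [k] above it; by convexity the box [w] above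
       [y] in the row of that [k] also holds [k], so [y] would be paired. *)
    rewrite leqNgt; apply/negP => k_x.
    have fx : f x = k' by apply/val_inj; move: fxy; rewrite fy /=; lia.
    have xP : x \in level f by rewrite inE fx eqxx orbT.
    have : partner (level f) x.
      move: xF; rewrite inE xP /= (ltn_trans cxy cy).
      by rewrite negbK.
    case xz: (partner (level f) x) => [z|] // _.
    have [zP zx czx] := partnerP xz.
    have fz : f z = k.
      move: zP; rewrite inE => /orP[/eqP // | /eqP fz].
      by case/eqP: zx; apply: (ssyt_col_inj sf); rewrite // fz fx.
    have rzx : r z < r x.
      case: (ltngtP (r z) (r x)) => // [gt|e].
        by have := sc _ _ (esym czx) gt; rewrite fz fx; lia.
      by case/eqP: zx; apply: coord_inj.
    have [w rw cw] : exists2 w, r w = r z & c w = c y.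
      by apply: (conv z y); lia.
    have fzw : f z <= f w by apply: sr => //; lia.
    have fwy : f w < f y by apply: sc => //; lia.
    have fw : f w = k by apply/val_inj; move: fzw fwy; rewrite fz fy /=; lia.
    have /(partner_freeN yF) /(_ cw) ewy : w \in level f by rewrite inE fw eqxx.
    by move: fwy; rewrite ewy ltnn.
  case: (boolP (y \in free (level f) j)) => yF; last first.
    rewrite (bk_nfree sf yF); have [+ +] := bk_free xF.
    have fxy := sr _ _ rxy cxy; have [_ cx] := freeP xF; rewrite !inE.
    case/orP=> /eqP fx /orP[] /eqP->; rewrite -?fx //; last first.
      by rewrite (leq_trans _ fxy) // fx kk'.
    (* The mirror image, with a [k'] below [y]. If [y] lies beyond the line, convexity gives instead
       a box of column [j] holding [k], against [colj]. *)
    rewrite kk' ltnNge; apply/negP => fyk.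
    have fy : f y = k by apply/val_inj; move: fxy; rewrite fx /=; lia.
    have yP : y \in level f by rewrite inE fy eqxx.
    have [cy|jcy] := ltnP (c y) j; last first.
      have [w rw cw] : exists2 w, r w = r y & c w = j by apply: (conv x y); lia.
      have fxw : f x <= f w by apply: sr => //; lia.
      have fwy : f w <= f y.
        case: (ltngtP (c w) (c y)) => [lt||e]; [by apply: sr|lia|].
        by rewrite (coord_inj rw e).
      have /eqP[] := colj _ cw; apply/val_inj.
      by move: fxw fwy; rewrite fx fy /=; lia.
    have : partner (level f) y by move: yF; rewrite inE yP cy negbK.
    case yz: (partner (level f) y) => [z|] // _.
    have [zP zy czy] := partnerP yz.
    have fz : f z = k'.
      move: zP; rewrite inE => /orP[/eqP fz | /eqP //].
      by case/eqP: zy; apply: (ssyt_col_inj sf); rewrite // fz fy.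
    have ryz : r y < r z.
      case: (ltngtP (r z) (r y)) => // [lt|e].
        by have := sc _ _ czy lt; rewrite fz fy; lia.
      by case/eqP: zy; apply: coord_inj.
    have [w rw cw] : exists2 w, r w = r z & c w = c x.
      by apply: (conv x z); lia.
    have fwz : f w <= f z by apply: sr => //; lia.
    have fxw : f x < f w by apply: sc => //; lia.
    have fw : f w = k' by apply/val_inj; move: fwz fxw; rewrite fz fx /=; lia.
    have /(partner_freeN xF) /(_ cw) ewx : w \in level f.
      by rewrite inE fw eqxx orbT.
    by move: fxw; rewrite ewx ltnn.
  have [/freeP[xP cx] /freeP[yP cy]] := (xF, yF).
  have [txF rtx] := tau_free_in xF; have [tyF rty] := tau_free_in yF.
  (* [tau] reverses the order of the free boxes of a row, and exchanging [k] and [k'] reverses it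
     back. *)
  have : f (tau (level f) j y) <= f (tau (level f) j x).
    have ctxy : c (tau (level f) j y) <= c (tau (level f) j x).
      rewrite !tau_free // rxy.
      by apply: rev_by_anti => //; rewrite inE ?xF ?yF ?rxy eqxx.
    move: ctxy; rewrite leq_eqVlt => /orP[/eqP e|lt].
      by rewrite (@coord_inj _ (tau (level f) j x) _ e) // rtx rty.
    by apply: sr => //; rewrite rtx rty.
  rewrite !ffunE cx cy.
  have [] := (tau_in (level f) j x, tau_in (level f) j y).
  rewrite xP yP !inE => /orP[]/eqP-> /orP[]/eqP->;
    rewrite ?tpermL ?tpermR //; lia.
- move=> cxy rxy; have fxy := sc _ _ cxy rxy.
  have xyN : x != y by apply/eqP=> e; rewrite e ltnn in rxy.
  (* The other box in the column of a free box has an entry outside [k], [k'], which compares alike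
     with both since they are consecutive. *)
  case: (boolP (x \in free (level f) j)) => xF.
    have yP : y \notin level f.
      apply/negP => /(partner_freeN xF) /(_ (esym cxy)) e.
      by rewrite e eqxx in xyN.
    rewrite (@bk_nfree f y) //; last by apply: contra yP => /freeP[].
    have [] := bk_free xF; move: yP fxy; rewrite !inE -!(inj_eq val_inj) /=.
    by case/norP=> _ + + /orP[]/eqP e1 /orP[]/eqP e2; lia.
  rewrite (bk_nfree sf xF).
  case: (boolP (y \in free (level f) j)) => yF; last by rewrite bk_nfree.
  have xP : x \notin level f.
    by apply/negP => /(partner_freeN yF) /(_ cxy) e; rewrite e eqxx in xyN.
  have [] := bk_free yF; move: xP fxy; rewrite !inE -!(inj_eq val_inj) /=.
  by case/norP=> + _ + /orP[]/eqP e1 /orP[]/eqP e2; lia.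
Qed.

End Swap.

End BenderKnuth.

(** * Kostka numbers and Yamanouchi fillings *)

Section Content.

Variables (X : finType) (r c : X -> nat) (n : nat).
Hypotheses (coord_inj : coord_injective r c) (conv : convex r c).

Implicit Types (f : {ffun X -> 'I_n}) (e d : 'I_n -> nat) (s : 'S_n).

Definition content f l := #|[pred x | f x == l]|.

(* The summand e avoids the subtraction in "content d - e". *)
Definition kostka e d :=
  #|[pred f | ssyt r c f && [forall l, content f l + e l == d l]]|.

Definition width := (\max_x c x).+1.

Lemma ltn_width x : c x < width.
Proof. by rewrite ltnS leq_bigmax. Qed.

Lemma eq_kostka e e' d d' : e =1 e' -> d =1 d' -> kostka e d = kostka e' d'.
Proof.
move=> ee dd; apply: eq_card => f; rewrite !inE; congr (_ && _).
by apply: eq_forallb => l; rewrite ee dd.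
Qed.

(** With the line at [width], [bk] acts on all columns, the condition on column [j] is vacuous, and
    the whole content is permuted. Used in both directions it gives equality. *)
Lemma kostka_adjacent_le (k k' : 'I_n) e d e' d' : k' = k.+1 :> nat ->
  e' =1 e \o tperm k k' -> d' =1 d \o tperm k k' -> kostka e d <= kostka e' d'.
Proof.
move=> kk' ee dd; pose F := bk r c width k k'.
have injF : {in [pred f | ssyt r c f && [forall l, content f l + e l == d l]] &,
    injective F}.
  apply: (can_in_inj (g := F)) => f; rewrite !inE => /andP[sf _].
  exact: bkK.
rewrite /kostka -(card_in_image injF); apply/subset_leq_card/subsetP => g.
case/imageP=> f; rewrite !inE => /andP[sf /forallP cf] ->; apply/andP; split.
  by apply: ssyt_bk => // x cx; have := ltn_width x; rewrite cx ltnn.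
apply/forallP => l; have := cf (tperm k k' l); rewrite ee dd /=.
congr (_ + _ == _).
apply: etrans (etrans _ (esym (card_bk width k k' coord_inj l sf))) _;
by apply: eq_card => x; rewrite !inE ltn_width.
Qed.

Definition kostka_inv s := forall e d, kostka (e \o s) (d \o s) = kostka e d.

Lemma kostka_inv_adjacent (k k' : 'I_n) : k' = k.+1 :> nat ->
  kostka_inv (tperm k k').
Proof.
move=> kk' e d; apply/eqP; rewrite eqn_leq.
by rewrite !(@kostka_adjacent_le k k') // => l /=; rewrite tpermK.
Qed.

Lemma kostka_invM s t : kostka_inv s -> kostka_inv t -> kostka_inv (s * t)%g.
Proof.
move=> invs invt e d; rewrite -[RHS]invt -[RHS]invs.
by apply: eq_kostka => l /=; rewrite permM.
Qed.

Lemma kostka_inv1 : kostka_inv 1%g.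
Proof. by move=> e d; apply: eq_kostka => l /=; rewrite perm1. Qed.

Lemma kostka_inv_tperm (i k : 'I_n) : kostka_inv (tperm i k).
Proof.
wlog ik : i k / i < k => [lt_inv|].
  case: (ltngtP i k) => [|ki|/val_inj->]; first exact: lt_inv.
    by rewrite tpermC; apply: lt_inv.
  by rewrite tperm1; apply: kostka_inv1.
move: {2}(k - i) (erefl (k - i)) => m.
elim: m k ik => [|m IHm] k ik km; first lia.
case: (posnP m) => [m0|m_gt0]; first by apply: kostka_inv_adjacent; lia.
have lt_h : k.-1 < n by have := ltn_ord k; lia.
pose h := Ordinal lt_h.
have kh : k = h.+1 :> nat by rewrite /=; lia.
(* Induction on [k - i]: [(i k)] is [(i h)] conjugated by the adjacent transposition [(h k)]. *)
have -> : tperm i k = (tperm h k * (tperm i h * tperm h k))%g.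
  have := tpermJ i h (tperm h k).
  rewrite /conjg tpermV tpermL tpermD //; apply/eqP => /(congr1 val) /=; lia.
apply: kostka_invM; first exact: kostka_inv_adjacent.
apply: kostka_invM; last exact: kostka_inv_adjacent.
by apply: IHm => /=; lia.
Qed.

Lemma kostka_perm s : kostka_inv s.
Proof.
have [ts -> _] := prod_tpermP s.
elim/big_ind: _ => [|? ?|t _]; first exact: kostka_inv1.
  exact: kostka_invM.
exact: kostka_inv_tperm.
Qed.

(** * Lattice condition and Stembridge's sign-reversing involution *)

Definition right_content f j l := #|[pred x | (j <= c x) && (f x == l)]|.

Definition violates f j (k k' : 'I_n) :=
  (k' == k.+1 :> nat) && (right_content f j k < right_content f j k').

Definition yamanouchi f :=
  [forall j : 'I_width, forall k, forall k', ~~ violates f j k k'].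

Definition last_violation f (p : 'I_width * ('I_n * 'I_n)) :=
  violates f p.1 p.2.1 p.2.2 &&
  [forall q : 'I_width * ('I_n * 'I_n),
     (p.1 < q.1) ==> ~~ violates f q.1 q.2.1 q.2.2].

Lemma right_content_out f j l : width <= j -> right_content f j l = 0.
Proof.
move=> jw; apply: eq_card0 => x; rewrite !inE leqNgt.
by rewrite (leq_trans (ltn_width x) jw).
Qed.

Lemma yamanouchiP f :
  reflect (forall j (k k' : 'I_n), k' = k.+1 :> nat ->
             right_content f j k' <= right_content f j k) (yamanouchi f).
Proof.
apply: (iffP forallP) => [yf j k k' kk' | yf j].
  have [jw|jw] := ltnP j width; last by rewrite !right_content_out.
  have /forallP/(_ k)/forallP/(_ k') := yf (Ordinal jw).
  by rewrite /violates kk' eqxx -leqNgt.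
apply/forallP=> k; apply/forallP => k'; rewrite negb_and -leqNgt.
by case: eqP => //= /yf ->.
Qed.

Lemma yamanouchi_anti f (l l' : 'I_n) :
  yamanouchi f -> l <= l' -> content f l' <= content f l.
Proof.
move=> /yamanouchiP/(_ 0) yf.
have [m le_m] := ubnP l'; elim: m => // m IHm in l' le_m *.
rewrite leq_eqVlt => /orP[/eqP/val_inj->//|ll'].
have lt_h : l'.-1 < n by have := ltn_ord l'; lia.
apply: leq_trans (yf (Ordinal lt_h) l' _) (IHm (Ordinal lt_h) _ _) => /=; lia.
Qed.

Lemma last_violation_exists f : ~~ yamanouchi f -> exists p, last_violation f p.
Proof.
case/forallPn=> j0 /forallPn[k0 /forallPn[k0']]; rewrite negbK => v0.
pose v (p : 'I_width * ('I_n * 'I_n)) := violates f p.1 p.2.1 p.2.2.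
case: (@arg_maxnP _ (j0, (k0, k0')) v (fun p => p.1) v0) => p vp pmax.
exists p; rewrite /last_violation [violates _ _ _ _]vp; apply/forallP=> q.
apply/implyP; by apply: contraL => /pmax; rewrite -leqNgt.
Qed.

Lemma right_contentS f j l :
  right_content f j l =
  right_content f j.+1 l + #|[pred x | (c x == j) && (f x == l)]|.
Proof.
rewrite /right_content -[LHS](cardID [pred x | j < c x]).
by congr (_ + _); apply: eq_card => x; rewrite !inE; case: (f x == l); lia.
Qed.

Lemma content_split f j l :
  content f l = #|[pred x | (c x < j) && (f x == l)]| + right_content f j l.
Proof.
rewrite /content -[LHS](cardID [pred x | c x < j]).
by congr (_ + _); apply: eq_card => x; rewrite !inE -?leqNgt // andbC.
Qed.

Lemma card_col_le1 f j l : ssyt r c f ->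
  #|[pred x | (c x == j) && (f x == l)]| <= 1.
Proof.
move=> sf; apply/card_le1_eqP=> x y; rewrite !inE => /andP[/eqP cx /eqP fx].
case/andP=> /eqP cy /eqP fy; apply: (ssyt_col_inj coord_inj sf); congruence.
Qed.

(** The next line is not violated and column [j] holds at most one [k']; so it holds exactly one and
    no [k], and the excess is one. This is what [ssyt_bk] requires and what [rho] compensates. *)
Lemma last_violationP f j k k' : ssyt r c f -> last_violation f (j, (k, k')) ->
  [/\ k' = k.+1 :> nat,
      forall x, c x = j -> f x != k &
      right_content f j k' = (right_content f j k).+1].
Proof.
move=> sf /andP[/andP[/eqP kk' vj] /forallP vmax]; rewrite /= in kk' vj.
have next : right_content f j.+1 k' <= right_content f j.+1 k.
  have [jw|jw] := ltnP j.+1 width; last by rewrite !right_content_out.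
  have := vmax (Ordinal jw, (k, k')).
  by rewrite /= ltnSn /violates kk' eqxx -leqNgt.
have := card_col_le1 j k' sf.
move: vj; rewrite (right_contentS f j k) (right_contentS f j k') => vj col1.
split=> //; last by lia.
move=> x cx; apply/negP => fx.
have : 0 < #|[pred x | (c x == j) && (f x == k)]|.
  by apply/card_gt0P; exists x; rewrite inE cx eqxx.
lia.
Qed.

(** Being a last violation depends only on the columns from the line rightwards, which [bk] keeps.
    Hence [pick] chooses the same one for [f] and [flip f]. *)
Lemma eq_last_violation f (g : {ffun X -> 'I_n})
    (p0 : 'I_width * ('I_n * 'I_n)) :
    last_violation f p0 -> (forall x, p0.1 <= c x -> g x = f x) ->
  last_violation g =1 last_violation f.
Proof.
move=> vf0 gf.
have vE (q : 'I_width * ('I_n * 'I_n)) : p0.1 <= q.1 ->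
    violates g q.1 q.2.1 q.2.2 = violates f q.1 q.2.1 q.2.2.
  move=> pq; rewrite /violates; congr (_ && (_ < _));
  apply: eq_card => x; rewrite !inE; case: leqP => // qx;
  by rewrite gf ?(leq_trans pq).
have [vf _] := andP vf0.
move=> q; have [pq|qp] := leqP p0.1 q.1.
  rewrite /last_violation vE //; congr (_ && _); apply: eq_forallb => q'.
  by case: ltnP => // qq'; rewrite vE // (leq_trans pq (ltnW qq')).
rewrite /last_violation; case: andP => [[_ /forallP/(_ p0)]|_].
  by rewrite qp vE // vf.
by case: andP => // [[_ /forallP/(_ p0)]]; rewrite qp vf.
Qed.

Definition flip f :=
  if pick (last_violation f) is Some p then bk r c p.1 p.2.1 p.2.2 f else f.

Definition flip_perm f : 'S_n :=
  if pick (last_violation f) is Some p then tperm p.2.1 p.2.2 else 1%g.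

Definition rho (l : 'I_n) := n - l.

(** Left of the line the counts of [k] and [k'] are exchanged; right of it [k'] leads by one, which
    cancels against the unit step of [rho]. So content plus [rho] is permuted by the
    transposition. *)
Lemma flipP f : ssyt r c f -> ~~ yamanouchi f ->
  [/\ ssyt r c (flip f), ~~ yamanouchi (flip f), flip (flip f) = f &
  [/\ flip_perm (flip f) = flip_perm f, involutive (flip_perm f),
      odd_perm (flip_perm f) &
      forall l, content (flip f) l + rho l =
                content f (flip_perm f l) + rho (flip_perm f l)]].
Proof.
move=> sf /last_violation_exists exp.
have [[j [k k']] Ef vp] : exists2 p, pick (last_violation f) = Some p &
    last_violation f p.
  by case: pickP => [p|no]; [exists p | case: exp => p; rewrite no].
have [kk' colj cont_j] := last_violationP sf vp.
have flipE : flip f = bk r c j k k' f by rewrite /flip Ef.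
have permE : flip_perm f = tperm k k' by rewrite /flip_perm Ef.
have eqv : last_violation (flip f) =1 last_violation f.
  by apply: (eq_last_violation vp) => x; rewrite flipE; apply: bk_right.
have Ef' : pick (last_violation (flip f)) = Some (j, (k, k')).
  by rewrite (eq_pick eqv).
have kNk' : k != k' by apply/eqP => /(congr1 val) /=; lia.
split.
- by rewrite flipE; apply: ssyt_bk.
- have := vp; rewrite -eqv => /andP[v _].
  by apply/forallPn; exists j; apply/forallPn; exists k; apply/forallPn;
    exists k'; rewrite negbK.
- by rewrite {1}/flip Ef' flipE /= bkK.
rewrite permE; split; first by rewrite /flip_perm Ef'.
- exact: tpermK.
- by rewrite odd_tperm.
move=> l; rewrite flipE (content_split _ j) (content_split f j) card_bk //.
have -> : right_content (bk r c j k k' f) j l = right_content f j l.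
  by apply: eq_card => x; rewrite !inE; case: leqP => // /bk_right ->.
rewrite /rho; case: tpermP => [->|->|//]; have := ltn_ord k'; lia.
Qed.

(** * LR numbers as alternating sums of Kostka numbers *)

Definition lr_number (a : 'I_n -> nat) :=
  #|[pred f | [&& ssyt r c f, yamanouchi f & [forall l, content f l == a l]]]|.

Local Open Scope ring_scope.
Import GRing.Theory.

Lemma increasing_perm_geq (s : 'S_n) :
  (forall l l' : 'I_n, (l < l')%N -> (s l < s l')%N) ->
  forall l : 'I_n, (l <= s l)%N.
Proof.
move=> s_incr [m lt_m]; elim: m lt_m => // m IHm lt_m.
exact: leq_ltn_trans (IHm (ltnW lt_m)) (s_incr (Ordinal (ltnW lt_m)) _ _).
Qed.

Lemma increasing_perm1 (s : 'S_n) :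
  (forall l l' : 'I_n, (l < l')%N -> (s l < s l')%N) -> s = 1%g.
Proof.
move=> s_incr; apply/permP=> l; apply/val_inj/eqP; rewrite perm1 eqn_leq.
rewrite increasing_perm_geq // andbT.
have sV_incr (i i' : 'I_n) : (i < i')%N -> ((s^-1)%g i < (s^-1)%g i')%N.
  move=> ii'; rewrite ltnNge leq_eqVlt; apply/negP.
  case/orP=> [/eqP/val_inj/perm_inj e|].
    by rewrite e ltnn in ii'.
  by move/s_incr; rewrite !permKV ltnNge (ltnW ii').
by have := increasing_perm_geq sV_incr (s l); rewrite permK.
Qed.

Lemma lr_number_kostka (a : 'I_n -> nat) :
    (forall l l' : 'I_n, (l <= l')%N -> (a l' <= a l)%N) ->
  (lr_number a)%:Z =
  \sum_(s : 'S_n) (-1) ^+ s * (kostka rho (fun l => a (s l) + rho (s l))%N)%:Z.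
Proof.
move=> a_anti.
pose good (p : 'S_n * {ffun X -> 'I_n}) := ssyt r c p.2 &&
  [forall l, content p.2 l + rho l == a (p.1 l) + rho (p.1 l)]%N.
have -> : \sum_(s : 'S_n) (-1) ^+ s *
            (kostka rho (fun l => a (s l) + rho (s l))%N)%:Z =
          \sum_(p | good p) (-1) ^+ p.1 :> int.
  rewrite -(pair_big_dep xpredT (fun s f => good (s, f))
    (fun s _ => (-1) ^+ s)) /=.
  by apply: eq_bigr => s _; rewrite sumr_const -natz mulr_natr; congr (_ *+ _).
rewrite (bigID (fun p => yamanouchi p.2)) /=.
rewrite [X in _ = _ + X](_ : _ = 0) ?addr0; last first.
  pose bad p := good p && ~~ yamanouchi p.2.
  (* The transposition that permutes content plus [rho] is absorbed into the permutation, whose sign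
     changes. *)
  pose psi (p : 'S_n * {ffun X -> 'I_n}) := ((flip_perm p.2 * p.1)%g, flip p.2).
  have psiP p : bad p -> bad (psi p) /\ psi (psi p) = p.
    case: p => s f /andP[/andP[/= sf /forallP cf] yf].
    have [sff yff ffK [pK pI _ contE]] := flipP sf yf.
    split.
      rewrite /bad /good /= sff yff andbT /=; apply/forallP => l.
      by rewrite contE permM.
    rewrite /psi /= ffK pK mulgA; congr (_, _).
    by apply/permP=> l; rewrite !permM pI.
  pose S : int := \sum_(p | bad p) (-1) ^+ p.1.
  suff : S = - S by rewrite -[X in X = 0]/S; lia.
  rewrite {1}/S (reindex_onto psi psi) => [|p /psiP[] //]; rewrite -sumrN.
  apply: eq_big => [p|p].
    apply/andP/idP => [[/psiP[+ _] /eqP e]|/psiP[-> ->]//]; first by rewrite e.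
  case/andP=> /psiP[+ _] /eqP e; rewrite e => /andP[/andP[sf _] yf].
  have [_ _ _ [_ _ odd_f _]] := flipP sf yf.
  by rewrite /= odd_permM odd_f addTb signrN.
transitivity (\sum_(p : 'S_n * {ffun X -> 'I_n} | (p.1 == 1%g) &&
   [&& ssyt r c p.2, yamanouchi p.2 & [forall l, content p.2 l == a l]])
   (-1) ^+ p.1 : int).
  rewrite -(pair_big (pred1 1%g)
    (fun f => [&& ssyt r c f, yamanouchi f & [forall l, content f l == a l]])
    (fun (s : 'S_n) _ => (-1) ^+ s)) /=.
  by rewrite big_pred1_eq odd_perm1 sumr_const natz.
apply: eq_bigl => -[s f]; rewrite /good /=.
case sf: (ssyt r c f) => /=; last by rewrite andbF.
case yf: (yamanouchi f) => /=; rewrite ?andbF // andbT.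
apply/andP/forallP => [[/eqP-> /forallP cf] l|cf].
  by rewrite perm1 (eqP (cf l)).
(* Both [content f + rho] and [a + rho] are strictly decreasing, so [s] preserves the order. *)
suff s1 : s = 1%g.
  split; first exact/eqP.
  by apply/forallP=> l; have := cf l; rewrite s1 perm1 eqn_add2r.
apply: increasing_perm1 => l l' ll'; rewrite ltnNge; apply/negP => ss.
have := yamanouchi_anti yf (ltnW ll'); have := a_anti _ _ ss.
have := cf l; have := cf l'; rewrite /rho.
by have := ltn_ord l'; have := ltn_ord (s l); lia.
Qed.

End Content.

(** * Rotation of the shape *)

Section Rotation.

Variables (X : finType) (r c : X -> nat) (n M : nat).
Hypotheses (coord_inj : coord_injective r c) (conv : convex r c).
Hypotheses (r_le : forall x, r x <= M) (c_le : forall x, c x <= M).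

Definition rotate (u : X -> nat) x := M - u x.

Lemma coord_injective_rotate : coord_injective (rotate r) (rotate c).
Proof.
move=> x y; have := r_le x; have := r_le y; have := c_le x; have := c_le y.
by rewrite /rotate => *; apply: coord_inj; lia.
Qed.

Lemma convex_rotate : convex (rotate r) (rotate c).
Proof.
rewrite /rotate => x y i j ri cj.
have rxM := r_le x; have ryM := r_le y; have cxM := c_le x; have cyM := c_le y.
have [z rz cz] : exists2 z, r z = M - i & c z = M - j.
  by apply: (conv (x := y) (y := x)); lia.
by exists z; lia.
Qed.

Lemma kostka_rotate (e d : 'I_n -> nat) :
  kostka (rotate r) (rotate c) e d = kostka r c e d.
Proof.
pose w : 'S_n := perm (@rev_ord_inj n).
rewrite -(kostka_perm coord_inj conv w e d).
pose F (f : {ffun X -> 'I_n}) := [ffun x => rev_ord (f x)].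
have FK : involutive F by move=> f; apply/ffunP=> x; rewrite !ffunE rev_ordK.
rewrite /kostka -[RHS](card_image (inv_inj FK)); apply: eq_card => f.
rewrite -[in RHS](FK f) (mem_image (inv_inj FK)) !inE; congr (_ && _).
  apply/ssytP/ssytP => -[sr sc]; split=> x y exy lt;
  move: (sr y x) (sc y x) exy lt (ltn_ord (f x)) (ltn_ord (f y));
  move: (r_le x) (r_le y) (c_le x) (c_le y);
  by rewrite !ffunE /rotate /=; lia.
have cF l : content (F f) l = content f (rev_ord l).
  apply: eq_card => x.
  by rewrite !inE ffunE (can2_eq (@rev_ordK n) (@rev_ordK n)).
apply/forallP/forallP => cf l.
  by rewrite /= permE cF.
by have := cf (rev_ord l); rewrite /= permE cF rev_ordK.
Qed.

(** The alternating sum sees the shape only through its Kostka numbers. *)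
Lemma lr_number_rotate (a : 'I_n -> nat) :
    (forall l l' : 'I_n, l <= l' -> a l' <= a l) ->
  lr_number (rotate r) (rotate c) a = lr_number r c a.
Proof.
move=> a_anti; have inj' := coord_injective_rotate; have conv' := convex_rotate.
suff: Posz (lr_number (rotate r) (rotate c) a) = lr_number r c a by case.
rewrite !lr_number_kostka //; apply: eq_bigr => s _.
by rewrite kostka_rotate.
Qed.

End Rotation.

(** * Tableaux as fillings with entries numbered from 0 *)

Section Boxes.

Variables be ga : seq nat.
Hypotheses (be_part : is_partition be) (ga_part : is_partition ga).

Lemma partition_nth_anti la i j : is_partition la -> i <= j ->
  nth 0 la j <= nth 0 la i.
Proof.
move=> /andP[la_sorted _] ij; have [j_lt|j_ge] := ltnP j (size la); last first.
  by rewrite nth_default.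
have geq_trans : transitive geq by move=> y x z /= yx zy; apply: leq_trans yx.
apply: (sorted_leq_nth geq_trans leqnn 0 la_sorted) => //.
exact: leq_ltn_trans j_lt.
Qed.

Lemma box_coord_injective : coord_injective (@brow be ga) (@bcol be ga).
Proof.
move=> x y rxy cxy; apply/val_inj; apply/pair_eqP/andP.
by split; apply/eqP/val_inj.
Qed.

Lemma box_bounds (x : box be ga) :
  [/\ nth 0 ga (bcol x) <= brow x, brow x < nth 0 be (bcol x),
      brow x < head 0 be & bcol x < size be].
Proof. by have /andP[] := valP x; split=> //; apply: ltn_ord. Qed.

Lemma box_convex : convex (@brow be ga) (@bcol be ga).
Proof.
move=> x y i j /andP[xi iy] /andP[xj jy].
have [gx _ _ _] := box_bounds x; have [_ bey hy sy] := box_bounds y.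
have hi := leq_ltn_trans iy hy; have hj := leq_ltn_trans jy sy.
have ij : in_skew ga (Ordinal hi, Ordinal hj).
  apply/andP; split=> /=.
    by apply: leq_trans (partition_nth_anti ga_part xj) (leq_trans gx xi).
  by apply: leq_trans (partition_nth_anti be_part jy); apply: leq_ltn_trans bey.
by exists (exist (fun z => in_skew ga z) _ ij : box be ga).
Qed.

End Boxes.

(** * LR-tableaux and socle tableaux as lattice fillings of the shape and its rotation *)

Section Transfer.

Variables al be ga : seq nat.
Local Notation n := (head 0 al).
Local Notation M := (head 0 be + size be).
Local Notation row := (@brow be ga).
Local Notation col := (@bcol be ga).

Implicit Types (f : {ffun box be ga -> 'I_n}).

Definition parts_content (l : 'I_n) := transpose al l.+1.

Lemma parts_content_anti (l l' : 'I_n) :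
  l <= l' -> parts_content l' <= parts_content l.
Proof. by move=> ll'; apply: sub_count => i /=; apply: leq_trans. Qed.

(** The type [filling] allows the entry 0, which [has_content] excludes; lifting past [ord0] reaches
    exactly the positive fillings. *)
Definition shift f : filling al be ga := [ffun x => lift ord0 (f x)].

Lemma shift_inj : injective shift.
Proof.
move=> f g /ffunP fg; apply/ffunP=> x.
by have := fg x; rewrite !ffunE => /lift_inj.
Qed.

Lemma shiftE f x : shift f x = (f x).+1 :> nat.
Proof. by rewrite ffunE. Qed.

Lemma card_shift (P : pred (filling al be ga))
    (Q : pred {ffun box be ga -> 'I_n}) :
    (forall T, P T -> has_content T) -> (forall f, P (shift f) = Q f) ->
  #|P| = #|Q|.
Proof.
move=> Ppos PQ; rewrite -(card_image shift_inj); apply: eq_card => T.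
rewrite -!topredE /=; apply/idP/imageP => [PT|[f Qf ->]]; last by rewrite PQ.
have /fin_all_exists[f fT] x : exists i, T x = lift ord0 i.
  have /andP[/forallP/(_ x) T_gt0 _] := Ppos _ PT.
  have [|i -> _] := @unlift_some _ ord0 (T x); last by exists i.
  by rewrite -(inj_eq val_inj) /= eq_sym -lt0n.
have TE : T = shift (finfun f) by apply/ffunP=> x; rewrite !ffunE fT.
by exists (finfun f); rewrite // -[_ \in _]PQ -TE.
Qed.

Lemma has_content_shift f :
  has_content (shift f) = [forall l, content f l == parts_content l].
Proof.
have contE (l : 'I_n) : #|[pred x | shift f x == l.+1 :> nat]| = content f l.
  by apply: eq_card => x; rewrite !inE shiftE eqSS.
apply/andP/forallP => [[_ /forallP cf] l|cf].
  by have := cf (lift ord0 l); rewrite /= contE.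
split; first by apply/forallP=> x; rewrite shiftE.
apply/forallP=> l; apply/implyP; case: (unliftP ord0 l) => [l' ->|->] // _.
by rewrite /= contE.
Qed.

Lemma ssyt_LR f : LR1 (shift f) && LR2 (shift f) = ssyt row col f.
Proof.
apply/andP/ssytP => [[/forallP lr1 /forallP lr2]|[sr sc]].
  split=> x y /eqP exy lt;
  [have /forallP/(_ y) := lr1 x | have /forallP/(_ y) := lr2 x];
  by rewrite !shiftE exy lt.
by split; apply/forallP=> x; apply/forallP=> y; apply/implyP=> /andP[/eqP e lt];
  rewrite !shiftE; [apply: sr|apply: sc].
Qed.

Lemma ssyt_ST f :
  ST1 (shift f) && ST2 (shift f) = ssyt (rotate M row) (rotate M col) f.
Proof.
have bnd x : row x <= M /\ col x <= M.
  by have [_ _ ? ?] := box_bounds x; lia.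
apply/andP/ssytP => [[/forallP st1 /forallP st2]|[sr sc]].
  split=> x y; have [? ?] := bnd x; have [? ?] := bnd y;
    rewrite /rotate => exy lt.
    have /forallP/(_ x) := st1 y; rewrite !shiftE => /implyP; apply.
    by apply/andP; split; lia.
  have /forallP/(_ x) := st2 y; rewrite !shiftE => /implyP; apply.
  by apply/andP; split; lia.
split; apply/forallP=> x; apply/forallP=> y; apply/implyP=> /andP[/eqP e lt];
  have [? ?] := bnd x; have [? ?] := bnd y; rewrite !shiftE.
  by apply: sr; rewrite /rotate; lia.
by apply: sc; rewrite /rotate; lia.
Qed.

Lemma shift_neq_large f x l : n <= l -> (shift f x == l.+1 :> nat) = false.
Proof. by move=> nl; rewrite shiftE eqSS; have := ltn_ord (f x); lia. Qed.

Lemma yamanouchi_LR f : LR3 (shift f) = yamanouchi col f.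
Proof.
have contE j (l : 'I_n) :
    entries_right (shift f) j l.+1 = right_content col f j l.
  by apply: eq_card => x; rewrite !inE shiftE eqSS.
apply/LR3P/yamanouchiP => [lr3 j k k' kk'|yf j [//|l] _].
  by rewrite -!contE kk' lr3.
have [lt|ge] := ltnP l.+1 n; last first.
  by rewrite [leqLHS]eq_card0 // => x; rewrite !inE shift_neq_large ?andbF.
by rewrite (contE j (Ordinal lt)) (contE j (Ordinal (ltnW lt))) yf.
Qed.

Lemma yamanouchi_ST f : ST3 (shift f) = yamanouchi (rotate M col) f.
Proof.
(* For a column [c <= M], [j <= M - c] is equivalent to [c < M.+1 - j], also under truncated
   subtraction. *)
have contE j (l : 'I_n) :
    entries_left (shift f) (M.+1 - j) l.+1 = right_content (rotate M col) f j l.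
  apply: eq_card => x; rewrite !inE shiftE eqSS; congr (_ && _).
  by have [_ _ _ ?] := box_bounds x; rewrite /rotate; lia.
(* The double subtraction caps [j] at [M.+1], a line with every box on its left. *)
have leftE j l : entries_left (shift f) j l =
    entries_left (shift f) (M.+1 - (M.+1 - j)) l.
  apply: eq_card => x; rewrite !inE; congr (_ && _).
  by have [_ _ _ ?] := box_bounds x; lia.
apply/ST3P/yamanouchiP => [st3 j k k' kk'|yf j [//|l] _].
  by rewrite -!contE kk' st3.
have [lt|ge] := ltnP l.+1 n; last first.
  by rewrite [leqLHS]eq_card0 // => x; rewrite !inE shift_neq_large ?andbF.
rewrite leftE [leqRHS]leftE.
by rewrite (contE _ (Ordinal lt)) (contE _ (Ordinal (ltnW lt))) yf.
Qed.

Lemma LR_coef_lr_number : included ga be ->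
  LR_coef al be ga = lr_number row col parts_content.
Proof.
move=> incl; apply: card_shift => [T /and5P[] //|f].
rewrite /LR_tableau incl has_content_shift yamanouchi_LR /= andbA -ssyt_LR.
by rewrite andbC -!andbA; do !bool_congr.
Qed.

Lemma card_socle_tableau : included ga be ->
  #|@socle_tableau al be ga| =
  lr_number (rotate M row) (rotate M col) parts_content.
Proof.
move=> incl; apply: card_shift => [T /and5P[] //|f].
rewrite /socle_tableau incl has_content_shift yamanouchi_ST /= andbA -ssyt_ST.
by rewrite andbC -!andbA; do !bool_congr.
Qed.

End Transfer.

Theorem corollary4p8 (al be ga : seq nat)
  (al_part : is_partition al) (be_part : is_partition be)
  (ga_part : is_partition ga) :
  LR_coef al be ga = #|@socle_tableau al be ga|.
Proof.
have [incl|not_incl] := boolP (included ga be); last first.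
  rewrite /LR_coef !eq_card0 // => T; rewrite -topredE /=;
  by rewrite /socle_tableau /LR_tableau (negbTE not_incl).
rewrite LR_coef_lr_number // card_socle_tableau // lr_number_rotate //.
- exact: box_coord_injective.
- exact: box_convex.
- by move=> x; have [_ _ ? ?] := box_bounds x; lia.
- by move=> x; have [_ _ ? ?] := box_bounds x; lia.
- exact: parts_content_anti.
Qed.
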